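(* For $n\geq 0$, $$F_{2n}^I(x,y,q)=y^nq^{n(n-1)}+\sum_{j=0}^{n-1}x\,y^jq^{4nj-2j^2-4j+2n-1}F_{2n-2j-1}^I(x,y,q).$$
   Context: $S_n(123,132,213)$ is the set of permutations of $[n]$ with no subsequence order isomorphic to $123$, $132$ or $213$; each such $\pi$ is a concatenation of increasing blocks of size $1$ or $2$, each block larger than all later blocks. $s(\pi)$, $d(\pi)$ are the numbers of maximal increasing runs of $\pi$ of length $1$ and $2$, and $inv(\pi)$ is the number of inversions. $F_n^I(x,y,q)=\sum_{\pi\in S_n(123,132,213)}x^{s(\pi)}y^{d(\pi)}q^{inv(\pi)}$.
   Formalization: The first term is y^n q^{2n(n-1)} instead of the printed y^n q^{n(n-1)}, which is false for every n ≥ 2: for n = 2 the only permutation without runs of length 1 is 3412, which has 4 inversions, not 2. *)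

(* Defs.v *)
From HB Require Import structures.
From mathcomp Require Import all_boot all_order all_fingroup all_algebra.

Set Implicit Arguments.
Unset Strict Implicit.
Unset Printing Implicit Defensive.

Import GRing.Theory.

(* Permutations of [n] are elements of 'S_n, i.e. the values are 0, ..., n - 1;
   all the notions below depend only on the relative order of the values. *)
Definition one_line (n : nat) (pi : 'S_n) : seq nat :=
  [seq nat_of_ord (pi i) | i <- enum 'I_n].

(* [f] gives the positions of a subsequence of [pi] order isomorphic to the
   pattern [p], a sequence of distinct naturals such as [:: 1; 3; 2]. *)
Definition contains (n : nat) (p : seq nat) (pi : 'S_n) : bool :=
  [exists f : {ffun 'I_(size p) -> 'I_n},
    [forall i : 'I_(size p), forall j : 'I_(size p), (i < j) ==>
      ((f i < f j) && ((pi (f i) < pi (f j)) == (nth 0 p i < nth 0 p j)))]].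

Definition avoiders (ps : seq (seq nat)) (n : nat) : {set 'S_n} :=
  [set pi : 'S_n | all (fun p => ~~ contains p pi) ps].

Definition S123_132_213 (n : nat) : {set 'S_n} :=
  avoiders [:: [:: 1; 2; 3]; [:: 1; 3; 2]; [:: 2; 1; 3]] n.

(* The maximal increasing runs of a word, from left to right. *)
Fixpoint runs (w : seq nat) : seq (seq nat) :=
  if w is a :: w' then
    if runs w' is (b :: r) :: rs then
      if a < b then (a :: b :: r) :: rs else [:: a] :: (b :: r) :: rs
    else [:: [:: a]]
  else [::].

Definition nb_runs (k : nat) (n : nat) (pi : 'S_n) : nat :=
  count (fun r => size r == k) (runs (one_line pi)).

Definition stat_s (n : nat) (pi : 'S_n) : nat := nb_runs 1 pi.
Definition stat_d (n : nat) (pi : 'S_n) : nat := nb_runs 2 pi.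

Definition stat_inv (n : nat) (pi : 'S_n) : nat :=
  #|[set ij : 'I_n * 'I_n | (ij.1 < ij.2) && (pi ij.2 < pi ij.1)]|.

(* The polynomial F_n^I, evaluated at arbitrary elements of a commutative ring;
   an identity valid for all R, x, y, q is an identity of polynomials (take for
   R the polynomial ring in three variables over the integers). *)
Definition FI (R : comNzRingType) (n : nat) (x y q : R) : R :=
  (\sum_(pi in S123_132_213 n)
     x ^+ stat_s pi * y ^+ stat_d pi * q ^+ stat_inv pi)%R.

(* Main.v *)
Require Import Defs.
From HB Require Import structures.
From mathcomp Require Import all_boot all_order all_fingroup all_algebra.
From mathcomp Require Import zify ring.

(* An injective word avoids 123, 132 and 213 iff every letter exceeds all
   letters at distance at least two to its right, because these three patterns
   are exactly those of length 3 whose first letter is below the last one.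
   Hence such a permutation of [n+2] starts either with its maximum, or with
   its two largest values in increasing order, so that
     F_{n+2} = x q^{n+1} F_{n+1} + y q^{2n} F_n,
   and the theorem results from iterating this on the second summand. *)

Import GRing.Theory.

(** * Words of avoiders and their recursive enumeration *)

Fixpoint far_decreasing (w : seq nat) : bool :=
  if w is a :: w' then all (gtn a) (behead w') && far_decreasing w' else true.

Fixpoint word_inv (w : seq nat) : nat :=
  if w is a :: w' then count (gtn a) w' + word_inv w' else 0.

Fixpoint avoider_words (n : nat) : seq (seq nat) :=
  match n with
  | 0 => [:: [::]]
  | 1 => [:: [:: 0]]
  | (m.+1 as k).+1 =>
      [seq k :: w | w <- avoider_words k]
      ++ [seq m :: k :: w | w <- avoider_words m]
  end.

Lemma avoider_wordsSS (n : nat) :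
  avoider_words n.+2 = [seq n.+1 :: w | w <- avoider_words n.+1]
    ++ [seq [:: n, n.+1 & w] | w <- avoider_words n].
Proof. by []. Qed.

Lemma nat_ind2 (P : nat -> Prop) :
  P 0 -> P 1 -> (forall n, P n -> P n.+1 -> P n.+2) -> forall n, P n.
Proof.
move=> P0 P1 PS n; suff [] : P n /\ P n.+1 by [].
by elim: n => [|n [Pn PSn]]; split=> //; apply: PS.
Qed.

Lemma far_decreasingP (w : seq nat) :
  reflect (forall i k, i.+1 < k -> k < size w -> nth 0 w k < nth 0 w i)
          (far_decreasing w).
Proof.
elim: w => [|a w IHw] /=; first by apply: ReflectT.
apply: (iffP andP) => [[/(all_nthP 0) lt_a /IHw dec_w] [|i] [|k] //=|dec_aw].
- case: k => // k _; rewrite ltnS => lt_k.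
  have := lt_a k; rewrite size_behead nth_behead; apply; lia.
- by rewrite !ltnS; apply: dec_w.
split.
  apply/(all_nthP 0) => k; rewrite size_behead nth_behead => lt_k.
  by apply: (dec_aw 0 k.+2) => //; lia.
by apply/IHw => i k lt_ik lt_k; apply: (dec_aw i.+1 k.+1).
Qed.

Lemma perm_iota_head_max (n : nat) (w : seq nat) :
  perm_eq (n :: w) (iota 0 n.+1) = perm_eq w (iota 0 n).
Proof.
by rewrite -addn1 iotaD add0n perm_sym perm_catC /= perm_cons perm_sym.
Qed.

Lemma perm_iota_head_max2 (n : nat) (w : seq nat) :
  perm_eq [:: n, n.+1 & w] (iota 0 n.+2) = perm_eq w (iota 0 n).
Proof.
rewrite -(perm_iota_head_max n) -(perm_iota_head_max n.+1).
exact: (perm_catCA [:: n] [:: n.+1] w).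
Qed.

Lemma perm_iota_all_lt (n m : nat) (w : seq nat) :
  n <= m -> perm_eq w (iota 0 n) -> all (gtn m) w.
Proof.
move=> le_nm /perm_mem eq_w; apply/allP => k; rewrite eq_w mem_iota /=; lia.
Qed.

Lemma perm_iota_count_lt (n m : nat) (w : seq nat) :
  n <= m -> perm_eq w (iota 0 n) -> count (gtn m) w = n.
Proof.
move=> le_nm perm_w; rewrite -[RHS](size_iota 0) -(perm_size perm_w).
by apply/eqP; rewrite -all_count; apply: perm_iota_all_lt perm_w.
Qed.

Lemma mem_avoider_words (n : nat) (w : seq nat) :
  (w \in avoider_words n) = far_decreasing w && perm_eq w (iota 0 n).
Proof.
elim/nat_ind2: n w => [w|w|n IHn IHSn w].
- case: w => [|a w] //; rewrite inE andbC; symmetry.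
  by apply/negP => /andP[/perm_size].
- rewrite inE; apply/eqP/andP => [->//|[_ w_perm]].
  have /= := perm_size w_perm; case: w w_perm => [|a []] //= /perm_mem /(_ a).
  by rewrite !inE eqxx => /esym /eqP ->.
rewrite avoider_wordsSS mem_cat; apply/orP/andP.
- case=> /mapP[v]; rewrite ?IHn ?IHSn => /andP[dec_v perm_v] ->.
    rewrite perm_iota_head_max perm_v /= dec_v andbT; split=> //.
    by apply/allP => k /mem_behead; apply/allP; apply: perm_iota_all_lt perm_v.
  rewrite perm_iota_head_max2 perm_v /= dec_v andbT; split=> //.
  rewrite (perm_iota_all_lt n) //; apply/allP => k /mem_behead; apply/allP.
  exact: perm_iota_all_lt perm_v.
case: w => [|a w] [dec_w perm_w]; first by have := perm_size perm_w.
have le_a : a <= n.+1.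
  have := allP (perm_iota_all_lt _ _ _ (leqnn _) perm_w) a.
  by rewrite inE eqxx; apply.
have [eq_a|neq_a] := eqVneq a n.+1.
  left; rewrite eq_a; apply: map_f; rewrite IHSn.
  move: perm_w; rewrite eq_a perm_iota_head_max => ->.
  by case/andP: dec_w => _ dec_w; apply/andP.
(* The head [a] is not the maximum but exceeds every letter from the third on, so [n.+1] can only be
   the second letter. *)
right; case/andP: dec_w => /allP lt_a.
have : n.+1 \in a :: w by rewrite (perm_mem perm_w) mem_iota; lia.
rewrite inE eq_sym (negbTE neq_a) /=.
case: w lt_a perm_w => // b w lt_a perm_w; rewrite inE => /orP[/eqP eq_b|].
  2: by move=> /lt_a /=; lia.
subst b => /andP[_ dec_w].
(* If [n] came after [n.+1] it would be below [a], which is at most [n]; hence [a] is [n]. *)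
have : n \in [:: a, n.+1 & w] by rewrite (perm_mem perm_w) mem_iota; lia.
rewrite !inE (_ : (n == n.+1) = false) /=; last lia.
case/orP => [/eqP eq_a|/lt_a /=]; last lia.
subst a; apply: map_f; rewrite IHn; apply/andP; split=> //.
by rewrite perm_iota_head_max2 in perm_w.
Qed.

Lemma avoider_words_uniq (n : nat) : uniq (avoider_words n).
Proof.
elim/nat_ind2: n => // n IHn IHSn.
rewrite avoider_wordsSS cat_uniq !map_inj_uniq ?IHSn ?IHn ?andbT;
  try by move=> u v [].
apply/hasPn => _ /mapP[v _ ->]; apply/mapP => -[u _ [eq_n _]]; lia.
Qed.

(** * From permutations to words *)

Lemma size_one_line (n : nat) (pi : 'S_n) : size (one_line pi) = n.
Proof. by rewrite size_map size_enum_ord. Qed.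

Lemma nth_one_line (n : nat) (pi : 'S_n) (i : 'I_n) :
  nth 0 (one_line pi) i = pi i.
Proof. by rewrite (nth_map i) ?size_enum_ord // nth_ord_enum. Qed.

Lemma one_line_inj (n : nat) : injective (@one_line n).
Proof.
move=> s t eq_st; apply/permP => i; apply: val_inj.
by rewrite /= -!nth_one_line eq_st.
Qed.

Lemma one_lineP (n : nat) (w : seq nat) :
  reflect (exists pi : 'S_n, w = one_line pi) (perm_eq w (iota 0 n)).
Proof.
apply: (iffP (@tuple_permP _ n w (iota_tuple n 0))) => -[pi ->]; exists pi;
  by apply: eq_map => i; rewrite (tnth_nth 0) nth_iota ?add0n.
Qed.

Lemma containsP3 (n a b c : nat) (pi : 'S_n) :
  reflect (exists i j k : 'I_n,
    [/\ i < j, j < k, (pi i < pi j) = (a < b), (pi i < pi k) = (a < c)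
      & (pi j < pi k) = (b < c)])
    (contains [:: a; b; c] pi).
Proof.
apply: (iffP existsP) => [[f /forallP f_occ]|[i [j [k []]]]]; last first.
  move=> lt_ij lt_jk eij eik ejk.
  exists [ffun u : 'I_3 => nth i [:: i; j; k] u].
  apply/forallP => -[[|[|[|u]]] //= lt_u];
    apply/forallP => -[[|[|[|v]]] //= lt_v];
    rewrite !ffunE //=; apply/andP; split; rewrite ?eij ?eik ?ejk //; lia.
exists (f ord0), (f (inord 1)), (f ord_max).
have occ (u v : 'I_3) : u < v -> _ :=
  fun uv => implyP (forallP (f_occ u) v) uv.
have /andP[-> /eqP e1] : _ := occ ord0 (inord 1) ltac:(by rewrite inordK).
have /andP[-> /eqP e2] : _ := occ (inord 1) ord_max ltac:(by rewrite inordK).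
have /andP[_ /eqP e3] : _ := occ ord0 ord_max isT.
by rewrite e1 e2 e3 !inordK.
Qed.

Lemma S123_132_213P (n : nat) (pi : 'S_n) :
  (pi \in S123_132_213 n) = far_decreasing (one_line pi).
Proof.
rewrite inE /= andbT; apply/and3P/far_decreasingP.
  move=> [h123 h132 h213] i k lt_ik.
  rewrite size_one_line => lt_k.
  (* If the value at [i] is below the one at [k], the position [i.+1] between them completes a
     forbidden pattern; the size of its value decides which of the three. *)
  have lt_j : i.+1 < n by lia.
  have lt_i : i < n by lia.
  set I := Ordinal lt_i; set J := Ordinal lt_j; set K := Ordinal lt_k.
  rewrite (nth_one_line _ pi K) (nth_one_line _ pi I) ltnNge.
  apply/negP => le_ik.
  have neq (u v : 'I_n) : u < v -> pi u <> pi v :> nat.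
    by move=> lt_uv /val_inj /perm_inj eq_uv; rewrite eq_uv ltnn in lt_uv.
  have nIJ := neq I J (ltnSn _).
  have nIK : pi I <> pi K :> nat by apply: neq => /=; lia.
  have nJK := neq J K lt_ik.
  have [lt1|ge1] := ltnP (pi I) (pi J); have [lt2|ge2] := ltnP (pi J) (pi K).
  - by case/containsP3: h123; exists I, J, K; split=> //=; lia.
  - by case/containsP3: h132; exists I, J, K; split=> //=; lia.
  - by case/containsP3: h213; exists I, J, K; split=> //=; lia.
  - lia.
move=> dec.
(* Conversely, the outer positions of an occurrence are at distance at least two, while each pattern
   has its first letter below its last. *)
have lt_pi (i j k : 'I_n) : i < j -> j < k -> pi k < pi i.
  move=> lt_ij lt_jk; rewrite -!nth_one_line; apply: dec; first lia.
  by rewrite size_one_line.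
by split; apply/containsP3 => -[i [j [k [lt_ij lt_jk _ e _]]]];
  have := lt_pi i j k lt_ij lt_jk; move: e => /=; lia.
Qed.

Lemma perm_one_line_avoider_words (n : nat) :
  perm_eq [seq one_line pi | pi <- enum (S123_132_213 n)] (avoider_words n).
Proof.
apply: uniq_perm; rewrite ?avoider_words_uniq //.
  by rewrite map_inj_uniq ?enum_uniq //; apply: one_line_inj.
move=> w; rewrite mem_avoider_words; apply/mapP/andP.
  case=> pi; rewrite mem_enum S123_132_213P => dec ->; split=> //.
  by apply/one_lineP; exists pi.
case=> dec /one_lineP[pi eq_w]; exists pi => //.
by rewrite mem_enum S123_132_213P -eq_w.
Qed.

(** * Inversions and runs of words *)

Lemma word_invE (w : seq nat) :
  word_inv w = \sum_(i < size w) \sum_(j < size w)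
                 ((i < j) && (nth 0 w j < nth 0 w i)).
Proof.
elim: w => [|a w IHw] /=; first by rewrite big_ord0.
rewrite big_ord_recl big_ord_recl /= add0n; congr (_ + _).
  rewrite -sum1_count big_mkcond (big_nth 0) big_mkord.
  by apply: eq_bigr => j _; case: ifP => //= ->.
by rewrite IHw; apply: eq_bigr => i _; rewrite big_ord_recl.
Qed.

Lemma stat_invE (n : nat) (pi : 'S_n) : stat_inv pi = word_inv (one_line pi).
Proof.
rewrite word_invE size_one_line /stat_inv -sum1_card pair_big big_mkcond /=.
by apply: eq_bigr => -[i j] _; rewrite inE /= !nth_one_line; case: ifP.
Qed.

(** Exposes the head of the first run, so that the [match] in [runs] reduces to a comparison of two
    adjacent letters. *)
Lemma runs_cons (a : nat) (w : seq nat) :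
  exists r rs, runs (a :: w) = (a :: r) :: rs.
Proof.
by move=> /=; case: (runs w) => [|[|b r] rs] //; [| |case: ltnP => _];
  do 2 eexists.
Qed.

Lemma runs_cons_gt (a : nat) (w : seq nat) :
  all (gtn a) w -> runs (a :: w) = [:: a] :: runs w.
Proof.
case: w => // b w /= /andP[lt_ba _].
have [r [rs /= ->]] := runs_cons b w.
by rewrite ltnNge (ltnW lt_ba).
Qed.

Local Open Scope ring_scope.

(** * The recurrence and its iteration *)

Definition word_weight (R : comNzRingType) (x y q : R) (w : seq nat) : R :=
  x ^+ count (fun r => size r == 1) (runs w)
  * y ^+ count (fun r => size r == 2) (runs w) * q ^+ word_inv w.

Lemma FIE (R : comNzRingType) (n : nat) (x y q : R) :
  FI n x y q = \sum_(w <- avoider_words n) word_weight _ x y q w.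
Proof.
rewrite -(perm_big _ (perm_one_line_avoider_words n)) big_map big_enum.
by apply: eq_bigr => pi _; rewrite stat_invE.
Qed.

(** A leading maximum is a run of length 1 inverted with all [n.+1] later letters; a leading pair
    [n], [n.+1] is a run of length 2, each of whose letters is inverted with all [n] later ones. *)
Lemma FI_rec (R : comNzRingType) (n : nat) (x y q : R) :
  FI n.+2 x y q =
    x * q ^+ n.+1 * FI n.+1 x y q + y * q ^+ (2 * n) * FI n x y q.
Proof.
rewrite !FIE avoider_wordsSS big_cat !big_map !big_distrr.
congr (_ + _); apply: eq_big_seq => w; rewrite mem_avoider_words => /andP[_ pw].
  rewrite /word_weight runs_cons_gt ?(perm_iota_all_lt n.+1) //=.
  by rewrite (perm_iota_count_lt n.+1) // !exprD /=; ring.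
have runs_w : runs [:: n, n.+1 & w] = [:: n; n.+1] :: runs w.
  have /= -> := runs_cons_gt n.+1 w (perm_iota_all_lt _ _ _ (leqnSn n) pw).
  by rewrite ltnSn.
rewrite /word_weight runs_w /= ltnNge leqnSn /=.
rewrite !(perm_iota_count_lt n) // mul2n -addnn !exprD; ring.
Qed.

(* The source prints the first exponent as n(n-1), which is a misprint: it makes
   the identity false for every n >= 2, since the unique permutation with n runs
   of length 2 and none of length 1 has 2n(n-1) inversions (3412 has 4, not 2).
   None of the natural subtractions truncates when j < n. *)
Theorem theorem4p6 (R : comNzRingType) (n : nat) (x y q : R) :
  (FI (2 * n) x y q =
     y ^+ n * q ^+ (2 * n * (n - 1))%N
     + \sum_(j < n)
         x * y ^+ j
         * q ^+ (4 * n * j - 2 * j ^ 2 - 4 * j + 2 * n - 1)%N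
         * FI (2 * n - 2 * j - 1) x y q)%R.
Proof.
elim: n => [|n IHn].
  by rewrite big_ord0 FIE big_seq1 /word_weight /= !expr0 !mulr1 addr0.
(* The first summand of the recurrence is the term [j = 0]; the factor [y * q ^+ (2 * (2 * n))]
   turns the old leading term into the new one and the old term [j] into the term [j.+1]. *)
rewrite mulnS add2n FI_rec IHn big_ord_recl mulrDr addrCA /=.
congr (_ + (_ + _)).
- rewrite mulrACA -exprS -exprD; congr (_ * q ^+ _); nia.
- by rewrite expr0 mulr1; congr (_ * q ^+ _ * FI _ x y q); lia.
rewrite mulr_sumr; apply: eq_bigr => j _; rewrite /bump /= add1n.
have lt_j := ltn_ord j.
have -> : ((2 * n).+2 - 2 * j.+1 - 1 = 2 * n - 2 * j - 1)%N by lia.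
rewrite mulrA; congr (_ * _).
have -> : (4 * n.+1 * j.+1 - 2 * j.+1 ^ 2 - 4 * j.+1 + (2 * n).+2 - 1
  = 2 * (2 * n) + (4 * n * j - 2 * j ^ 2 - 4 * j + 2 * n - 1))%N.
  (* Writing [n] as [j + d.+1] makes it visible to [nia] that no subtraction truncates. *)
  have [d eq_n] : exists d, n = (j + d.+1)%N by exists (n - j.+1)%N; lia.
  nia.
by rewrite exprD exprS; ring.
Qed.
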